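(* Let $\mathcal D$ be a data cube and let $D_i$ be one of its dimensions. Then the operation $\mathsf{SLICE}(\mathcal D,D_i)$ is expressible as an OLAP operation.
   Context: **Dimensions.** A dimension $D$ has a schema $\sigma(D)$: a finite lattice, viewed as a directed graph of levels, with a unique top node $All$ (only incoming edges) and a unique bottom node $Bottom$ (only outgoing edges), all maximal-length paths going from $Bottom$ to $All$. A path from $Bottom$ to $All$ is a hierarchy of $\sigma(D)$. Each level $\ell$ has a non-empty finite set $dom(D.\ell)$, with $dom(D.All)=\{all\}$ and $dom(D.Bottom)=dom(D)$, and $dom(D)$ is totally ordered by $<$. A dimension graph $I(\sigma(D))$ is a directed acyclic graph with node set $\bigcup_\ell dom(D.\ell)$, in which an edge from $a\in dom(D.\ell)$ to $a'\in dom(D.\ell')$ can exist only if $\ell\to\ell'$ is an edge of $\sigma(D)$. For each hierarchy $H$, the subgraph $I_H(\sigma(D))$ on the nodes belonging to the levels of $H$ is a directed tree, directed towards its root $all$. Write $\rho_H(a,b)$ (''$a$ rolls up to $b$'') if $b$ is reachable from $a$ in $I_H(\sigma(D))$ (with $a$ rolling up to itself), and $\rho$ if $H$ is clear from the context. Dimension graphs are sound: for every level $\ell$, hierarchies $H_1,H_2$ reaching $\ell$ from $Bottom$, $a\in dom(D)$ and $b_1,b_2\in dom(D.\ell)$, $\rho_{H_1}(a,b_1)$ and $\rho_{H_2}(a,b_2)$ imply $b_1=b_2$. Every $b\in dom(D.\ell)$ has at least one $a\in dom(D)$ with $\rho(a,b)$; $rep(b)$ denotes the smallest such $a$. Put $b_1<b_2$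 in $dom(D.\ell)$ iff $rep(b_1)<rep(b_2)$. **Data cubes.** A $d$-dimensional data cube $\mathcal D$ ($d\ge1$) consists of: the matrix $M(\mathcal D)=dom(D_1)\times\cdots\times dom(D_d)$, whose elements are called cells; sound dimension graphs $I(\sigma(D_i))$; protected measures $\mu_1,\dots,\mu_k$ and computed measures $\tau_1,\dots,\tau_l$ ($l\ge0$), which are functions from the cells to $\mathbb Q$; and a flag $\varphi$ from the cells to $\{0,1\}$. Some cells may be empty (destroyed): they carry no measures and no flag, they are ignored in all computations, and no measure is ever added to them. **Prime labels.** These are the numbers $1,\sqrt2,\sqrt3,\sqrt5,\sqrt7,\dots,\sqrt{p_n},\dots$ ($p_n$ the $n$-th prime), used symbolically; intermediate computed measures may have values involving them. A prime product label is a product of prime labels coming from labelings of different dimensions that use disjoint sets of labels. If the label of a cell is the product of labels for the dimensions with index in $I\subseteq\{1,\dots,d\}$, then for a rational-valued measure $\mu$ the sum over all non-empty cells of $\mu$ times the label is called a (full or partial) prime sum; it can be written $\sum_w a_w w$, with $w$ ranging over the labels that occur. **Atomic OLAP transformations.** Each creates, in all non-empty cells $(x_1,\dots,x_d)$, a new measure $\tau_{new}$ from the existing measures; $\alpha,\beta$ denote existing (protected or computed) measures. - Arithmetic: $\tau_{new}=c$ with $c\in\mathbb Q$; $\tau_{new}=\alpha+\beta$; $\tau_{new}=\alpha\cdot\beta$; $\tau_{new}=\alpha/\beta$, with the convention $a/0:=a$. - Boolean (values $0/1$, cell per cell): $(\alpha=\beta)$; $(\alpha<\beta)$; $(\ell=c)$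 for a level $\ell$ of $\sigma(D_i)$ and $c\in dom(D_i.\ell)$, equal to $1$ iff $\rho(x_i,c)$; $(\ell<_\ell c)$, equal to $1$ iff $x_i$ rolls up to some $b\in dom(D_i.\ell)$ with $b<_\ell c$, where $<_\ell$ is any order defined on level $\ell$; similarly $(c<_\ell \ell)$. - Selectors: the constant selector $\sigma_{D_i.\ell=c}$, which equals the test $(\ell=c)$; the level selector $\sigma_{D_i.\ell}$, equal to $1$ iff $x_i=rep(b)$ for some $b\in dom(D_i.\ell)$, and $0$ otherwise. - Global aggregates (the same value in all non-empty cells): $\#_{\neq}(\alpha)$, the number of distinct values of $\alpha$ in the matrix; $\mathrm{SUM}_d(\alpha)$, the sum of $\alpha$ over all non-empty cells; $\min(\alpha)$; $\max(\alpha)$. - Grouped aggregates: if $\tau_m$ is a prime (product) labeling of the cells, then $\#_{\neq}|_{\tau_m}(\alpha)$, $\min|_{\tau_m}(\alpha)$ and $\max|_{\tau_m}(\alpha)$ are, in each cell $x$, the number of distinct values, minimum and maximum of $\alpha$ over the cells having the same label as $\tau_m(x)$. - Grouping: $\gamma_{D_i.\ell}$, where $dom(D_i.\ell)=\{b_1<\dots<b_s\}$: the next $s$ prime labels not yet used by earlier transformations are assigned in order to $b_1,\dots,b_s$, and a cell with $\rho(x_i,b_j)$ receives the label of $b_j$. Projection of a prime sum $\tau_m|_{\tau_n}$: if $\tau_m$ is a prime sum $\sum_w a_w w$ over the labels of an earlier prime (product) labeling $\tau_n$, the new measure has value $a_w$ in each cell where $\tau_n=w$. **OLAP operation (of arity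 $m$).** It is a finite sequence of $n$ atomic transformations creating $\tau_{l+1},\dots,\tau_{l+n}$, followed by the creation of a Boolean measure $\varphi^{(m)}$ (the output flag), optionally preceded by the creation of a Boolean measure $\delta$ (a destructor); $\delta$ and $\varphi^{(m)}$ are created by atomic transformations or set equal to existing Boolean measures. In the output cube, dimensions, schemas and dimension graphs are unchanged; cells with $\delta=0$ are emptied (even of their protected measures); in the other non-empty cells the measures are $\mu_1,\dots,\mu_k$, the last $m$ computed measures $\tau_{l+n-m+1},\dots,\tau_{l+n}$ (renamed $\tau_1,\dots,\tau_m$), and the new flag $\varphi^{(m)}$ replacing the old one. An operation on data cubes is expressible as an OLAP operation if there is an OLAP operation (its sequence of transformations being chosen from the parameters of the operation, the numbers of measures, and the dimension schemas and graphs) whose output on the input cube is the output of the operation. **Slice.** $\mathsf{SLICE}(\mathcal D,D_i)$ ''replaces'' (as computed output measures) the measures $\mu_1,\dots,\mu_k$ by their sums $\mu_n^{\Sigma_i}(x_1,\dots,x_d)=\sum_{y\in dom(D_i)}\mu_n(x_1,\dots,x_{i-1},y,x_{i+1},\dots,x_d)$, $1\le n\le k$ (sums over non-empty cells only); it destroys all cells except those with $x_i=rep(all)$ in dimension $D_i$, and the remaining cells get flag $1$. *)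

(* Defs.v *)
From HB Require Import structures.
From mathcomp Require Import all_boot all_order all_algebra.
From mathcomp Require Import boolp reals.

Set Implicit Arguments.
Unset Strict Implicit.
Unset Printing Implicit Defensive.

Import Order.TTheory GRing.Theory Num.Theory.

Local Open Scope ring_scope.

(* The edges generate the lattice order; they may but need not be the covering
   pairs (Hasse diagram).  Since the order is antisymmetric and edges are
   irreflexive, the graph is acyclic, the bottom element is the only level
   without incoming edges, the top element the only one without outgoing edges,
   and every inextensible path goes from the bottom to the top. *)
Record schema := Schema {
  level_display : Order.disp_t;
  level : finTBLatticeType level_display;
  level_edge : rel level;
  level_edge_irr : irreflexive level_edge;
  level_edgeP : forall a b : level, connect level_edge a b = (a <= b)%O }.

Definition Bottom (S : schema) : level S := (\bot)%O.
Definition All (S : schema) : level S := (\top)%O.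

Definition hierarchy (S : schema) (H : seq (level S)) : bool :=
  if H is a :: p then
    [&& a == Bottom S, path (@level_edge S) a p & last a p == All S]
  else false.

(* The nodes of a dimension graph: the disjoint union of the level domains. *)
Definition node (S : schema) (dom : level S -> finType) : finType :=
  {a : level S & dom a}.

Definition Node (S : schema) (dom : level S -> finType) (a : level S)
  (b : dom a) : node dom := Tagged (fun a => dom a) b.

Definition hsubgraph (S : schema) (dom : level S -> finType)
    (g : rel (node dom)) (H : seq (level S)) : rel (node dom) :=
  fun a b => [&& tag a \in H, tag b \in H & g a b].

Definition rolls_up_in (S : schema) (dom : level S -> finType)
    (g : rel (node dom)) (H : seq (level S)) (a b : node dom) : bool :=
  [&& tag a \in H, tag b \in H & connect (hsubgraph g H) a b].

(* Rolling up along some hierarchy; soundness makes the target in a given level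
   independent of the hierarchy. *)
Definition rolls_up (S : schema) (dom : level S -> finType)
    (g : rel (node dom)) (a b : node dom) : bool :=
  `[< exists H, hierarchy H /\ rolls_up_in g H a b >].

(* Directed tree on the vertex set V, directed towards its root r: from every
   vertex there is exactly one directed path to r. *)
Definition tree_towards (T : eqType) (V : pred T) (g : rel T) (r : T) : Prop :=
  V r /\
  forall a, V a -> exists! p : seq T, path g a p /\ last a p = r.

Record dimension := Dimension {
  sch :> schema;
  dom : level sch -> finType;
  dom_nonempty : forall a : level sch, (0 < #|dom a|)%N;
  dom_all : dom (All sch);
  dom_allP : forall b : dom (All sch), b = dom_all;
  dom_le : rel (dom (Bottom sch));
  dom_le_refl : reflexive dom_le;
  dom_le_anti : antisymmetric dom_le;
  dom_le_trans : transitive dom_le;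
  dom_le_total : total dom_le;
  (* the dimension graph; acyclic because the schema is *)
  dgraph : rel (node dom);
  dgraph_level : forall a b, dgraph a b -> level_edge (tag a) (tag b);
  dgraph_tree : forall H, hierarchy H ->
    tree_towards [pred a | tag a \in H] (hsubgraph dgraph H) (Node dom_all);
  dgraph_sound : forall (a : level sch) (H1 H2 : seq (level sch))
      (x : dom (Bottom sch)) (b1 b2 : dom a),
    hierarchy H1 -> hierarchy H2 ->
    rolls_up_in dgraph H1 (Node x) (Node b1) ->
    rolls_up_in dgraph H2 (Node x) (Node b2) -> b1 = b2;
  dgraph_covered : forall (a : level sch) (b : dom a),
    exists x : dom (Bottom sch), rolls_up dgraph (Node x) (Node b) }.

Definition rho (D : dimension) (x : dom (Bottom D)) (a : level D)
    (b : dom a) : bool := rolls_up (@dgraph D) (Node x) (Node b).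

Definition rep (D : dimension) (a : level D) (b : dom a) : dom (Bottom D) :=
  extremum (@dom_le D) (xchoose (dgraph_covered b)) (fun x => rho x b) id.

Definition level_lt (D : dimension) (a : level D) (b1 b2 : dom a) : bool :=
  (rep b1 != rep b2) && dom_le (rep b1) (rep b2).

Definition level_rank (D : dimension) (a : level D) (b : dom a) : nat :=
  #|[pred b' | level_lt b' b]|.

Definition cell (d : nat) (D : 'I_d -> dimension) : finType :=
  {dffun forall i : 'I_d, dom (Bottom (D i))}.

Record cell_data (k l : nat) := CellData {
  protected : {ffun 'I_k -> rat};
  computed : {ffun 'I_l -> rat};
  flag : bool }.

(* None marks an empty cell. *)
Definition cube (d : nat) (D : 'I_d -> dimension) (k l : nat) : Type :=
  {ffun cell D -> option (cell_data k l)}.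

Definition live (d : nat) (D : 'I_d -> dimension) (k l : nat)
    (X : cube D k l) : finType := {c : cell D | isSome (X c)}.

Definition content (d : nat) (D : 'I_d -> dimension) (k l : nat)
    (X : cube D k l) (x : live X) : cell_data k l :=
  match X (val x) as o return isSome o -> cell_data k l with
  | Some u => fun=> u
  | None => fun h => False_rect _ (notF h)
  end (valP x).

Lemma ex_prime_above (n : nat) : exists p, (n < p)%N && prime p.
Proof. by have [p ltnp pp] := prime_above n; exists p; rewrite ltnp. Qed.

Definition next_prime (n : nat) : nat := ex_minn (ex_prime_above n).

(* 1, sqrt 2, sqrt 3, sqrt 5, ...: the iterates are 1, 2, 3, 5, ... *)
Definition prime_label (R : rcfType) (n : nat) : R :=
  Num.sqrt (iter n next_prime 1%N)%:R.

(* References to existing measures; Comp is numbered from 0. *)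
Inductive measure_ref (k : nat) := Prot of 'I_k | Comp of nat.

(* Syntax of the atomic transformations.  ALevelEq is also the constant
   selector.  ALevelLt carries the order used in (level < c), ALevelGt the one
   used in (c < level).  The first argument of AGroupCount, AGroupMin and
   AGroupMax is the labeling; AProj m n projects the prime sum m to the
   labeling n. *)
Inductive atomic (d : nat) (D : 'I_d -> dimension) (k : nat) : Type :=
| AConst of rat
| AAdd of measure_ref k & measure_ref k
| AMul of measure_ref k & measure_ref k
| ADiv of measure_ref k & measure_ref k
| AEq of measure_ref k & measure_ref k
| ALt of measure_ref k & measure_ref k
| ALevelEq (i : 'I_d) (a : level (D i)) (c : dom a)
| ALevelLt (i : 'I_d) (a : level (D i)) (lt : rel (dom a)) (c : dom a)
| ALevelGt (i : 'I_d) (a : level (D i)) (lt : rel (dom a)) (c : dom a)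
| ALevelSel (i : 'I_d) (a : level (D i))
| ACount of measure_ref k
| ASum of measure_ref k
| AMin of measure_ref k
| AMax of measure_ref k
| AGroupCount of measure_ref k & measure_ref k
| AGroupMin of measure_ref k & measure_ref k
| AGroupMax of measure_ref k & measure_ref k
| AGroup (i : 'I_d) (a : level (D i))
| AProj of measure_ref k & measure_ref k.

(* A measure during the execution of an operation: a real value, possibly
   involving prime labels, in every non-empty cell. *)
Definition measure (R : rcfType) (d : nat) (D : 'I_d -> dimension) (k l : nat)
    (X : cube D k l) : Type := {ffun live X -> R}.

(* Computed measures so far, number of prime labels used so far, and the
   labelings created so far by groupings, with their dimensions. *)
Record state (R : rcfType) (d : nat) (D : 'I_d -> dimension) (k l : nat)
    (X : cube D k l) := State {
  st_computed : seq (measure R X);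
  st_used : nat;
  st_groupings : seq ('I_d * {ffun live X -> R}) }.

Definition lookup (R : rcfType) (d : nat) (D : 'I_d -> dimension) (k l : nat)
    (X : cube D k l) (st : state R X) (r : measure_ref k) :
    option (measure R X) :=
  match r with
  | Prot n => Some [ffun x => ratr (protected (content x) n)]
  | Comp j => onth (st_computed st) j
  end.

Definition prime_labeling (R : rcfType) (d : nat) (D : 'I_d -> dimension)
    (k l : nat) (X : cube D k l) (st : state R X) (t : measure R X) : Prop :=
  exists (J : {set 'I_d}) (g : 'I_d -> {ffun live X -> R}),
    (forall j, j \in J -> (j, g j) \in st_groupings st) /\
    t = [ffun x => \prod_(j in J) g j x].

Definition strict_order (T : Type) (lt : rel T) : Prop :=
  irreflexive lt /\ transitive lt.

(* creates st t tau: in the state st, the transformation t creates tau.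
   In minima and maxima the value in the cell x itself serves as the initial
   value, so no default is needed for an empty range. *)
Definition creates (R : rcfType) (d : nat) (D : 'I_d -> dimension) (k l : nat)
    (X : cube D k l) (st : state R X) (t : atomic D k) (tau : measure R X) :
    Prop :=
  let create (f : live X -> R) := tau = [ffun x => f x] in
  let create1 r (f : measure R X -> live X -> R) :=
    exists2 a : measure R X, lookup st r = Some a & create (f a) in
  let create2 r s (f : measure R X -> measure R X -> live X -> R) :=
    exists a b : measure R X,
      [/\ lookup st r = Some a, lookup st s = Some b & create (f a b)] in
  let create_grouped r s (f : measure R X -> measure R X -> live X -> R) :=
    exists g a : measure R X,
      [/\ lookup st r = Some g, prime_labeling st g, lookup st s = Some a &
          create (f g a)] in
  match t with
  | AConst c => create (fun=> ratr c)
  | AAdd r s => create2 r s (fun a b x => a x + b x)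
  | AMul r s => create2 r s (fun a b x => a x * b x)
  | ADiv r s => create2 r s (fun a b x => if b x == 0 then a x else a x / b x)
  | AEq r s => create2 r s (fun a b x => (a x == b x)%:R)
  | ALt r s => create2 r s (fun a b x => (a x < b x)%R%:R)
  | ALevelEq i _ c => create (fun x => (rho (val x i) c)%:R)
  | ALevelLt i a lt c =>
      strict_order lt /\
      create (fun x => [exists b : dom a, rho (val x i) b && lt b c]%:R)
  | ALevelGt i a lt c =>
      strict_order lt /\
      create (fun x => [exists b : dom a, rho (val x i) b && lt c b]%:R)
  | ALevelSel i a =>
      create (fun x => [exists b : dom a, val x i == rep b]%:R)
  | ACount r =>
      create1 r (fun a x => (size (undup [seq a y | y : live X]))%:R)
  | ASum r => create1 r (fun a x => \sum_(y : live X) a y)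
  | AMin r => create1 r (fun a x => \big[Num.min/a x]_(y : live X) a y)
  | AMax r => create1 r (fun a x => \big[Num.max/a x]_(y : live X) a y)
  | AGroupCount r s => create_grouped r s (fun g a x =>
      (size (undup [seq a y | y : live X in [pred y | g y == g x]]))%:R)
  | AGroupMin r s => create_grouped r s (fun g a x =>
      \big[Num.min/a x]_(y : live X | g y == g x) a y)
  | AGroupMax r s => create_grouped r s (fun g a x =>
      \big[Num.max/a x]_(y : live X | g y == g x) a y)
  | AGroup i a =>
      forall x : live X, exists2 b : dom a, rho (val x i) b &
        tau x = prime_label R (st_used st + level_rank b)%N
  | AProj r s =>
      exists (p g : measure R X) (mu : live X -> rat),
        [/\ lookup st r = Some p, lookup st s = Some g, prime_labeling st g,
            p = [ffun=> \sum_(y : live X) ratr (mu y) * g y] &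
            create (fun x => ratr (\sum_(y : live X | g y == g x) mu y))]
  end.

Definition extend (R : rcfType) (d : nat) (D : 'I_d -> dimension) (k l : nat)
    (X : cube D k l) (st : state R X) (t : atomic D k) (tau : measure R X) :
    state R X :=
  let comp := rcons (st_computed st) tau in
  match t with
  | AGroup i a =>
      State comp (st_used st + #|dom a|)%N
        (rcons (st_groupings st) (i, tau))
  | _ => State comp (st_used st) (st_groupings st)
  end.

Fixpoint exec (R : rcfType) (d : nat) (D : 'I_d -> dimension) (k l : nat)
    (X : cube D k l) (st : state R X) (ts : seq (atomic D k))
    (st' : state R X) : Prop :=
  if ts is t :: ts' then
    exists2 tau, creates st t tau & exec (extend st t tau) ts' st'
  else st' = st.

(* How a destructor or an output flag is obtained: by an atomic transformation,
   as a copy of an existing measure, or as a copy of the input flag. *)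
Inductive bool_source (d : nat) (D : 'I_d -> dimension) (k : nat) : Type :=
| BAtomic of atomic D k
| BMeasure of measure_ref k
| BFlag.

Definition boolean (R : rcfType) (d : nat) (D : 'I_d -> dimension) (k l : nat)
    (X : cube D k l) (tau : measure R X) : Prop :=
  forall x, tau x = 0 \/ tau x = 1.

Definition creates_bool (R : rcfType) (d : nat) (D : 'I_d -> dimension)
    (k l : nat) (X : cube D k l) (st : state R X) (b : bool_source D k)
    (tau : measure R X) (st' : state R X) : Prop :=
  let copied :=
    State (rcons (st_computed st) tau) (st_used st) (st_groupings st) in
  boolean tau /\
  match b with
  | BAtomic t => creates st t tau /\ st' = extend st t tau
  | BMeasure r => lookup st r = Some tau /\ st' = copied
  | BFlag => tau = [ffun x => (flag (content x))%:R] /\ st' = copied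
  end.

Record olap_operation (d : nat) (D : 'I_d -> dimension) (k : nat) :=
  OlapOperation {
    op_transformations : seq (atomic D k);
    op_destructor : option (bool_source D k);
    op_flag : bool_source D k }.

Definition init_state (R : rcfType) (d : nat) (D : 'I_d -> dimension)
    (k l : nat) (X : cube D k l) : state R X :=
  State [seq [ffun x : live X => ratr (computed (content x) j)] | j : 'I_l]
        0%N [::].

(* The destructor, run in the state st, destroys the cells with delta = 0. *)
Definition destroys (R : rcfType) (d : nat) (D : 'I_d -> dimension)
    (k l : nat) (X : cube D k l) (st : state R X)
    (ob : option (bool_source D k)) (delta : measure R X) (st' : state R X) :
    Prop :=
  match ob with
  | Some b => creates_bool st b delta st'
  | None => delta = [ffun x => 1] /\ st' = st
  end.

(* Y is an output, as an operation of arity m, of op on the input cube X.  The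
   output is a data cube, so the m output measures must be rational. *)
Definition olap_output (R : rcfType) (d : nat) (D : 'I_d -> dimension)
    (k l m : nat) (op : olap_operation D k) (X : cube D k l) (Y : cube D k m) :
    Prop :=
  exists (st st' st'' : state R X) (delta phi : measure R X),
  [/\ exec (init_state R X) (op_transformations op) st,
      (m <= size (st_computed st))%N,
      destroys st (op_destructor op) delta st',
      creates_bool st' (op_flag op) phi st'' &
      (forall c : cell D, X c = None -> Y c = None) /\
      (forall x : live X,
         if delta x == 0 then Y (val x) = None
         else exists y : cell_data k m,
           [/\ Y (val x) = Some y,
               protected y = protected (content x),
               forall j : 'I_m, ratr (computed y j) =
                 nth [ffun=> 0] (st_computed st)
                   (size (st_computed st) - m + j)%N x &
               (flag y)%:R = phi x])].

(* One operation serves for all input cubes with given dimensions and numbers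
   of measures.  Since olap_output is a relation, both the existence and the
   uniqueness of the output are required. *)
Definition expressible (R : rcfType) (d : nat) (D : 'I_d -> dimension)
    (k l m : nat) (F : cube D k l -> cube D k m) : Prop :=
  exists op : olap_operation D k,
    forall (X : cube D k l) (Y : cube D k m), olap_output R op X Y <-> Y = F X.

Definition cell_with (d : nat) (D : 'I_d -> dimension) (c : cell D) (i : 'I_d)
    (y : dom (Bottom (D i))) : cell D := finfun (dfwith c y).

Definition slice_sum (d : nat) (D : 'I_d -> dimension) (k l : nat)
    (X : cube D k l) (i : 'I_d) (n : 'I_k) (c : cell D) : rat :=
  \sum_(y : dom (Bottom (D i)))
    oapp (fun u => protected u n) 0 (X (cell_with c y)).

Definition slice (d : nat) (D : 'I_d -> dimension) (k l : nat) (i : 'I_d)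
    (X : cube D k l) : cube D k k :=
  [ffun c => if X c is Some u then
     if c i == rep (dom_all (D i)) then
       Some (CellData (protected u) [ffun n => slice_sum X i n c] true)
     else None
   else None].

(* Main.v *)
Require Import Defs.
From mathcomp Require Import all_boot all_order all_algebra.
From mathcomp Require Import boolp reals.

(* The sequence of transformations may depend on the dimensions, so no prime
   labels are needed: the tests (Bottom = b) and products give the indicator
   [x = c] of a cell c and the indicator [y ~ c] of the cells y that agree with
   c outside dimension i, and the slice sum of mu in a cell x is
     sum_c [x = c] * SUM_y (mu(y) * [y ~ c]),
   a fixed finite combination of constants, products, sums and SUM.  The
   destructor is the level selector of All, which holds exactly in the cells
   with x_i = rep(all). *)

Set Implicit Arguments.
Unset Strict Implicit.
Unset Printing Implicit Defensive.

Import GRing.Theory Num.Theory.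

Local Open Scope ring_scope.

(** * Roll-up within the bottom level *)

Lemma hierarchy_exists (S : schema) : exists H : seq (level S), hierarchy H.
Proof.
have : connect (@level_edge S) (Bottom S) (All S).
  by rewrite level_edgeP Order.le0x.
by case/connectP=> p pP lastp; exists (Bottom S :: p); rewrite /= pP -lastp !eqxx.
Qed.

(** Every bottom element rolls up to itself along any hierarchy, so soundness at the bottom level
    leaves no other target. The converse needs at least one hierarchy to exist. *)
Lemma rho_bottom (D : dimension) (x b : dom (Bottom D)) : rho x b = (x == b).
Proof.
have refl H : hierarchy H -> rolls_up_in (@dgraph D) H (Node x) (Node x).
  case: H => [//|a p] /and3P[/eqP-> _ _].
  by rewrite /rolls_up_in /= mem_head connect0.
apply/asboolP/eqP => [[H [hH xb]]|<-].
  exact: (dgraph_sound hH hH (refl H hH) xb).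
by have [H hier] := hierarchy_exists D; exists H; split=> //; apply: refl.
Qed.

Lemma rep_all (D : dimension) (x : dom (Bottom D)) :
  [exists b : dom (All D), x == rep b] = (x == rep (dom_all D)).
Proof.
apply/existsP/eqP => [[b /eqP->]|->]; first by rewrite (dom_allP b).
by exists (dom_all D).
Qed.

(** * Programs and the measures that they can create *)

Section Programs.

Variables (R : rcfType) (d : nat) (D : 'I_d -> dimension) (k l : nat).

Local Notation atom := (@atomic d D k).

Lemma contentE (X : cube D k l) (x : live X) : X (val x) = Some (content x).
Proof. by rewrite /content; move: (valP x); case: (X (val x)). Qed.

(** [exec] unfolds at the head, whereas programs are built below by appending at the end. *)
Lemma exec_rcons (X : cube D k l) (st : state R X) (p : seq atom) (t : atom) st' :
  exec st (rcons p t) st' <->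
  exists2 st1, exec st p st1 &
    exists2 tau, creates st1 t tau & st' = extend st1 t tau.
Proof.
elim: p st => [|u p IH] st /=.
  split=> [[tau ct ->]|[_ -> [tau ct ->]]]; last by exists tau.
  by exists st => //; exists tau.
split=> [[tau cu /IH[st1 e1 e2]]|[st1 [tau cu e1] e2]].
  by exists st1 => //; exists tau.
by exists tau => //; apply/IH; exists st1.
Qed.

(* Programs are chosen before the input cube, so the measures that they create
   are families indexed by the input cube. *)
Definition umeasure := forall X : cube D k l, live X -> R.

(** No grouping is ever run, so the label counter and the list of groupings keep their initial
    values. *)
Definition ustate (s : seq umeasure) (X : cube D k l) : state R X :=
  let: State init used groupings := init_state R X in
  State (init ++ [seq [ffun x => f X x] | f : umeasure <- s]) used groupings.

(** An equivalence, because [expressible] asks for existence and uniqueness of the output: the run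
    neither fails nor branches. *)
Definition reaches (p : seq atom) (s : seq umeasure) :=
  forall X st, exec (init_state R X) p st <-> st = ustate s X.

Definition available (s : seq umeasure) (r : measure_ref k) (f : umeasure) :=
  forall X, lookup (ustate s X) r = Some [ffun x => f X x].

Definition defines (s : seq umeasure) (t : atom) (f : umeasure) :=
  forall X, (forall tau, creates (ustate s X) t tau <-> tau = [ffun x => f X x])
    /\ extend (ustate s X) t [ffun x => f X x] = ustate (rcons s f) X.

(** Starting from an arbitrary [s] lets constructions be chained; [s] stays a prefix of the new
    list, so earlier measures remain available. *)
Definition computable (f : umeasure) :=
  forall p s, reaches p s ->
  exists p' s' r, reaches p' (s ++ s') /\ available (s ++ s') r f.

Lemma reaches_nil : reaches [::] [::].
Proof. by move=> X st; rewrite /= /ustate /= cats0. Qed.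

Lemma reaches_rcons p s t f :
  reaches p s -> defines s t f -> reaches (rcons p t) (rcons s f).
Proof.
move=> ps tf X st; have [cf ef] := tf X.
rewrite exec_rcons; split=> [[_ /ps-> [tau /cf-> ->]] //|->].
by exists (ustate s X); [apply/ps|exists [ffun x => f X x] => //; apply/cf].
Qed.

Lemma ustate_extend s f X :
  ustate (rcons s f) X =
  State (rcons (st_computed (ustate s X)) [ffun x => f X x]) 0 [::].
Proof. by rewrite /ustate /= map_rcons rcons_cat. Qed.

Lemma available_cat s s' r f : available s r f -> available (s ++ s') r f.
Proof.
move=> sf X; have := sf X; case: r {sf} => [//|j] /=.
rewrite map_cat catA => h; rewrite onth_cat; case: ltnP => // hj.
by rewrite onth_default in h.
Qed.

Lemma available_last s f :
  available (rcons s f) (Comp k (l + size s)) f.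
Proof.
(* The [l] computed measures of the input cube precede those of [s], whence the index
   [l + size s]. *)
move=> X; rewrite ustate_extend /= -cats1 onth_cat size_cat size_image.
by rewrite size_map card_ord ltnn subnn.
Qed.

Lemma computable_defined f t : (forall s, defines s t f) -> computable f.
Proof.
move=> tf p s ps; exists (rcons p t), [:: f], (Comp k (l + size s)).
rewrite cats1; split; last exact: available_last.
exact: reaches_rcons.
Qed.

(** * The transformations used and the closure properties that they give *)

Lemma computable_prot n : computable (fun X x => ratr (protected (content x) n)).
Proof. by move=> p s ps; exists p, [::], (Prot n); rewrite cats0. Qed.

Lemma defines_const s q : defines s (AConst D k q) (fun X x => ratr q).
Proof. by move=> X; split=> //; rewrite ustate_extend. Qed.

Lemma defines_level_eq s j a (c : dom a) :
  defines s (ALevelEq k c) (fun X x => (rho (val x j) c)%:R).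
Proof. by move=> X; split=> //; rewrite ustate_extend. Qed.

Lemma defines_add s r q f g : available s r f -> available s q g ->
  defines s (AAdd D r q) (fun X x => f X x + g X x).
Proof.
move=> sf sg X; split; last by rewrite ustate_extend.
have E : [ffun x => [ffun x => f X x] x + [ffun x => g X x] x] =
    [ffun x => f X x + g X x] :> measure R X by apply/ffunP=> x; rewrite !ffunE.
move=> tau; split=> [[a [b []]]|->].
  by rewrite sf sg => -[<-] [<-] ->; exact: E.
by exists [ffun x => f X x], [ffun x => g X x]; rewrite sf sg; split=> //; rewrite E.
Qed.

Lemma defines_mul s r q f g : available s r f -> available s q g ->
  defines s (AMul D r q) (fun X x => f X x * g X x).
Proof.
move=> sf sg X; split; last by rewrite ustate_extend.
have E : [ffun x => [ffun x => f X x] x * [ffun x => g X x] x] =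
    [ffun x => f X x * g X x] :> measure R X by apply/ffunP=> x; rewrite !ffunE.
move=> tau; split=> [[a [b []]]|->].
  by rewrite sf sg => -[<-] [<-] ->; exact: E.
by exists [ffun x => f X x], [ffun x => g X x]; rewrite sf sg; split=> //; rewrite E.
Qed.

Lemma defines_sum s r f : available s r f ->
  defines s (ASum D r) (fun X x => \sum_(y : live X) f X y).
Proof.
move=> sf X; split; last by rewrite ustate_extend.
have E : [ffun x => \sum_(y : live X) [ffun x => f X x] y] =
    [ffun x => \sum_(y : live X) f X y] :> measure R X.
  by apply/ffunP=> x; rewrite !ffunE; apply: eq_bigr => y _; rewrite ffunE.
move=> tau; split=> [[a]|->]; first by rewrite sf => -[<-] ->; exact: E.
by exists [ffun x => f X x]; rewrite ?sf // E.
Qed.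

Lemma computable_step2 (t : measure_ref k -> measure_ref k -> atom)
    (f g h : umeasure) :
  (forall s r q, available s r f -> available s q g -> defines s (t r q) h) ->
  computable f -> computable g -> computable h.
Proof.
move=> tP cf cg p s /cf[p1 [s1 [r [/cg[p2 [s2 [q [ps sg]]]] sf]]]].
exists (rcons p2 (t r q)), (rcons (s1 ++ s2) h), (Comp k (l + size (s ++ s1 ++ s2))).
rewrite -rcons_cat catA in ps sg *; split; last exact: available_last.
by apply: reaches_rcons => //; apply: tP => //; apply: available_cat.
Qed.

Lemma computable_const q : computable (fun X x => ratr q).
Proof. by apply: computable_defined => s; apply: defines_const. Qed.

Lemma computable_level_eq j a (c : dom a) :
  computable (fun X x => (rho (val x j) c)%:R).
Proof. by apply: computable_defined => s; apply: defines_level_eq. Qed.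

Lemma computable_add f g : computable f -> computable g ->
  computable (fun X x => f X x + g X x).
Proof. by apply: computable_step2 => s r q; apply: defines_add. Qed.

Lemma computable_mul f g : computable f -> computable g ->
  computable (fun X x => f X x * g X x).
Proof. by apply: computable_step2 => s r q; apply: defines_mul. Qed.

Lemma computable_sum f : computable f ->
  computable (fun X x => \sum_(y : live X) f X y).
Proof.
(* The unary case follows from the binary one by taking [f] twice and ignoring the second
   reference. *)
move=> cf; apply: (computable_step2 (t := fun r _ => ASum D r) _ cf cf).
by move=> s r _ sf _; apply: defines_sum.
Qed.

Lemma eq_umeasure (f g : umeasure) : (forall X x, f X x = g X x) -> f = g.
Proof. by move=> fg; apply: functional_extensionality_dep => X; apply/funext. Qed.

Lemma computable_bigsum (I : Type) (r : seq I) (F : I -> umeasure) :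
  (forall c, computable (F c)) ->
  computable (fun X x => \sum_(c <- r) F c X x).
Proof.
move=> cF; elim: r => [|c r IH].
  rewrite (_ : (fun X x => _) = fun X x => ratr 0); first exact: computable_const.
  by apply: eq_umeasure => X x; rewrite big_nil rmorph0.
rewrite (_ : (fun X x => _) = fun X x => F c X x + \sum_(c <- r) F c X x).
  exact: computable_add.
by apply: eq_umeasure => X x; rewrite big_cons.
Qed.

Lemma computable_bigprod (I : Type) (r : seq I) (P : pred I) (F : I -> umeasure) :
  (forall c, computable (F c)) ->
  computable (fun X x => \prod_(c <- r | P c) F c X x).
Proof.
move=> cF; elim: r => [|c r IH].
  rewrite (_ : (fun X x => _) = fun X x => ratr 1); first exact: computable_const.
  by apply: eq_umeasure => X x; rewrite big_nil rmorph1.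
case Pc: (P c).
  rewrite (_ : (fun X x => _) = fun X x => F c X x * \prod_(c <- r | P c) F c X x).
    exact: computable_mul.
  by apply: eq_umeasure => X x; rewrite big_cons Pc.
rewrite (_ : (fun X x => _) = fun X x => \prod_(c <- r | P c) F c X x) //.
by apply: eq_umeasure => X x; rewrite big_cons Pc.
Qed.

(** An output consists of the last computed measures, while the [F n] may be protected or scattered
    among intermediate results. All are computed first, then copied in order to the end. *)
Lemma reaches_family m (F : 'I_m -> umeasure) : (forall n, computable (F n)) ->
  exists p s, reaches p (s ++ [seq F n | n : 'I_m]).
Proof.
move=> cF.
(* The constant 0, referred to by [z], is the summand used for copying. *)
have [p0 [s0 [z [ps0 sz]]]] := computable_const 0 reaches_nil.
have [p1 [s1 [ps1 sF]]] : exists p s, reaches p (s0 ++ s) /\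
    forall n, n \in enum 'I_m -> exists r, available (s0 ++ s) r (F n).
  elim: (enum 'I_m) => [|n ns [p [s [ps IH]]]]; first by exists p0, [::]; rewrite cats0.
  have [p' [s' [r [ps' sr]]]] := cF n _ _ ps.
  exists p', (s ++ s'); rewrite catA; split=> // n'.
  rewrite inE => /predU1P[->|/IH[r' sr']]; first by exists r.
  by exists r'; apply: available_cat.
suff [p ps] : exists p, reaches p ((s0 ++ s1) ++ [seq F n | n : 'I_m]).
  by exists p, (s0 ++ s1).
rewrite /image_mem.
elim/last_ind: (enum 'I_m) sF => [|ns n IH] sF; first by exists p1; rewrite cats0.
have [|p ps] := IH; first by move=> n' n'ns; apply: sF; rewrite mem_rcons inE n'ns orbT.
have [|r sr] := sF n; first by rewrite mem_rcons mem_head.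
(* Adding 0 copies [F n] to the last position in a single transformation. *)
exists (rcons p (AAdd D r z)); rewrite map_rcons -rcons_cat.
apply: reaches_rcons => //.
have -> : F n = fun X x => F n X x + ratr 0.
  by apply: eq_umeasure => X x; rewrite rmorph0 addr0.
by apply: defines_add; [apply: available_cat|rewrite -catA; apply: available_cat].
Qed.

(** * The slice sum as a computable measure *)

Lemma prod_coord (P : pred 'I_d) (x c : cell D) :
  \prod_(j | P j) (rho (x j) (c j))%:R =
  [forall (j | P j), x j == c j]%:R :> R.
Proof.
case: forall_inP => [xc|/forall_inP/forall_inPn[j Pj /negPf xj]].
  by apply: big1 => j Pj; rewrite rho_bottom xc.
by rewrite (bigD1 j) //= rho_bottom xj mul0r.
Qed.

Definition usum (i : 'I_d) (n : 'I_k) : umeasure := fun X x =>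
  \sum_(c : cell D) (\prod_j (rho (val x j) (c j))%:R) *
    \sum_(y : live X) (ratr (protected (content y) n) *
      \prod_(j | j != i) (rho (val y j) (c j))%:R).

Lemma computable_usum i n : computable (usum i n).
Proof.
apply: computable_bigsum => c; apply: computable_mul.
  by apply: computable_bigprod => j; apply: computable_level_eq.
apply: computable_sum; apply: computable_mul; first exact: computable_prot.
by apply: computable_bigprod => j; apply: computable_level_eq.
Qed.

Lemma cell_withE (c : cell D) i (y : dom (Bottom (D i))) : cell_with c y i = y.
Proof. by rewrite ffunE dfwith_in. Qed.

(** Empty cells contribute the default 0 on the right, which is the convention of [slice_sum]. *)
Lemma sum_live (X : cube D k l) (P : pred (cell D)) n :
  \sum_(y : live X | P (val y)) protected (content y) n =
  \sum_(c | P c) oapp (fun u => protected u n) 0 (X c).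
Proof.
rewrite [RHS](bigID (fun c => isSome (X c))) /= [Z in _ + Z]big1 ?addr0; last first.
  by move=> c /andP[_]; case: (X c).
rewrite (reindex_omap (val : live X -> cell D) insub) /=; last first.
  by move=> c /andP[_ Xc]; rewrite insubT.
apply: eq_big => [y|y _]; last by rewrite contentE.
by rewrite valK eqxx andbT (valP y) andbT.
Qed.

Lemma usumE i n (X : cube D k l) (x : live X) :
  @usum i n X x = ratr (slice_sum X i n (val x)).
Proof.
(* Only the summand [c = val x] survives, since the full product of tests vanishes at every other
   [c]. *)
rewrite /usum (bigD1 (val x)) //= [Z in _ + Z]big1 => [|c cx].
  rewrite addr0 prod_coord; case: forall_inP => [_|[] //]; rewrite mul1r.
  rewrite (eq_bigr (fun y : live X => ratr (if [forall (j | j != i), val y j == val x j]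
     then protected (content y) n else 0))); last first.
    by move=> y _; rewrite prod_coord; case: ifP; rewrite ?mulr1 ?mulr0 ?rmorph0.
  rewrite -rmorph_sum -big_mkcond /=; congr ratr.
  rewrite (sum_live X (fun y : cell D => [forall (j | j != i), y j == val x j])).
  (* The cells agreeing with [val x] outside [i] are parametrized by their coordinate [i], with
     inverse [cell_with (val x)]. *)
  rewrite /slice_sum (reindex_onto (fun y => cell_with (val x) y) (fun c : cell D => c i)).
    apply: eq_bigl => y; rewrite cell_withE eqxx andbT; apply/forall_inP => j ji.
    by rewrite ffunE dfwith_out // eq_sym.
  move=> c /forall_inP cx; apply/ffunP => j; rewrite ffunE.
  have [<-|ij] := eqVneq i j; first by rewrite dfwith_in.
  by rewrite dfwith_out //; apply/esym/eqP/cx; rewrite eq_sym.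
rewrite prod_coord; case: forall_inP => [xc|_]; last by rewrite mul0r.
by case/eqP: cx; apply/ffunP => j; apply/esym/eqP/xc.
Qed.

End Programs.

(* R is the field of real numbers, in which the intermediate measures take
   their values. *)
Theorem mainTheorem3 (R : realType) (d : nat) (D : 'I_d -> dimension)
    (k l : nat) (i : 'I_d) :
  @expressible R d D k l k (@slice d D k l i).
Proof.
have [p [s ps]] := reaches_family (@computable_usum R d D k l i).
exists (OlapOperation p (Some (BAtomic (ALevelSel k (All (D i)))))
  (BAtomic (AConst D k 1))) => X Y.
set st := ustate (s ++ [seq @usum R d D k l i n | n : 'I_k]) X.
pose delta : measure R X := [ffun x : live X => (val x i == rep (dom_all (D i)))%:R].
have size_st : size (st_computed st) = (l + size s + k)%N.
  by rewrite /= size_cat size_image size_map size_cat size_image !card_ord addnA.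
have nth_st (j : 'I_k) x :
    nth [ffun=> 0] (st_computed st) (size (st_computed st) - k + j) x =
    ratr (slice_sum X i j (val x)).
  rewrite size_st addnK /= map_cat nth_cat size_image card_ord -addnA.
  rewrite ltnNge leq_addr /= addKn nth_cat size_map ltnNge leq_addr /= addKn.
  (* The index is in range, so the defaults of [nth] are immaterial and may be changed to fit each
     type. *)
  rewrite (nth_map (fun _ _ => 0)) ?size_image ?card_ord // ffunE.
  by rewrite (nth_map j) ?size_enum_ord // nth_ord_enum usumE.
have deltaE : [ffun x : live X =>
    [exists b : dom (All (D i)), val x i == rep b]%:R] = delta.
  by apply/ffunP=> x; rewrite !ffunE rep_all.
have delta_eq0 x : (delta x == 0) = (val x i != rep (dom_all (D i))).
  by rewrite ffunE pnatr_eq0 eqb0.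
(* First, any output equals the slice, as every created measure is forced; then the slice is shown
   to be an output. *)
split=> [[st1 [st2 [st3 [delta' [phi]]]]]|->].
  case=> /ps est _ [_ [edelta _]] [_ [ephi _]] [dead alive].
  rewrite /= deltaE in edelta; rewrite /= in ephi; subst st1 delta' phi; apply/ffunP => c; rewrite ffunE.
  case Xc: (X c) => [u|]; last exact: dead.
  have Xc' : isSome (X c) by rewrite Xc.
  have := alive (exist _ c Xc').
  have := contentE (exist _ c Xc' : live X).
  rewrite /= Xc => -[<-]; rewrite delta_eq0 /=.
  case: eqP => //= _ [[pr co fl] /= [-> -> coE flE]].
  congr (Some (CellData _ _ _)).
    (* Outputs are compared through their images in [R], and [ratr] is injective. *)
    by apply/ffunP=> j; have := coE j; rewrite nth_st ffunE => /fmorph_inj.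
  move: flE; rewrite ffunE rmorph1; case: (fl) => // /eqP.
  by rewrite eq_sym oner_eq0.
(* The constant flag is created in the same way in every state, so the state after the destructor
   can stay abstract. *)
have [st2 e2] : exists st2, st2 = extend st (ALevelSel k (All (D i))) delta by eexists.
exists st, st2, (extend st2 (AConst D k 1) [ffun=> ratr 1]), delta, [ffun=> ratr 1].
split; first exact/ps.
- by rewrite size_st leq_addl.
- split; last by rewrite /= deltaE.
  by move=> x; rewrite ffunE; case: eqP; [right|left].
- by split=> // x; rewrite ffunE rmorph1; right.
split=> [c Xc|x]; first by rewrite ffunE Xc.
rewrite delta_eq0 ffunE contentE; case: eqP => //= _.
eexists; split; first by [].
- by [].
- by move=> j; rewrite nth_st ffunE.
by rewrite ffunE [RHS]rmorph1.
Qed.
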